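(* For each $a\in\{0,1,2\}$, the set $\left\{\frac{n}{3^{\lfloor\|n\|/3\rfloor}}: \|n\|\equiv a\pmod 3,\ n \text{ stable}\right\}$ is reverse well-ordered (well-ordered under the reverse of the usual order on $\mathbb{R}$), with reverse order type $\omega^\omega$. Equivalently, for each $a\in\{0,1,2\}$ the same holds for the set $\left\{\frac{n}{E(\|n\|)}: \|n\|\equiv a\pmod 3,\ n\text{ stable}\right\}$.
   Context: $\|n\|$ is the complexity of a positive integer $n$: the least number of $1$'s needed to write $n$ using $1$, $+$, $\times$ and parentheses. A positive integer $n$ is stable if $\|3^kn\|=3k+\|n\|$ for all $k\ge1$. $E(k)$ denotes the largest positive integer of complexity at most $k$. *)

(* Defs.v *)
From mathcomp Require Import all_boot all_order all_algebra.
From mathcomp Require Import boolp classical_sets functions reals.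

Set Implicit Arguments.
Unset Strict Implicit.
Unset Printing Implicit Defensive.

Import Order.TTheory GRing.Theory Num.Theory.

Inductive expr : Type :=
  | One
  | Add of expr & expr
  | Mul of expr & expr.

Fixpoint value (e : expr) : nat :=
  match e with
  | One => 1
  | Add e1 e2 => value e1 + value e2
  | Mul e1 e2 => value e1 * value e2
  end.

Fixpoint ones (e : expr) : nat :=
  match e with
  | One => 1
  | Add e1 e2 | Mul e1 e2 => ones e1 + ones e2
  end.

Lemma ones_gt0 e : 0 < ones e.
Proof. by elim: e => //= e1 h1 e2 _; rewrite addn_gt0 h1. Qed.

Lemma value_gt0 e : 0 < value e.
Proof.
by elim: e => //= e1 h1 e2 h2; rewrite ?addn_gt0 ?muln_gt0 ?h1 ?h2.
Qed.

Lemma value_le_expn e : value e <= 2 ^ ones e.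
Proof.
elim: e => //= e1 h1 e2 h2; rewrite expnD; last exact: leq_mul.
apply: leq_trans (leq_add h1 h2) _.
have g1 : 2 <= 2 ^ ones e1 by rewrite -[X in X <= _](expn1 2) leq_exp2l ?ones_gt0.
have g2 : 2 <= 2 ^ ones e2 by rewrite -[X in X <= _](expn1 2) leq_exp2l ?ones_gt0.
case: (leqP (2 ^ ones e1) (2 ^ ones e2)) => [le12|/ltnW le21].
  apply: leq_trans (leq_mul g1 (leqnn _)).
  by rewrite mul2n -addnn leq_add2r.
apply: leq_trans (leq_mul (leqnn _) g2).
by rewrite muln2 -addnn leq_add2l.
Qed.

Definition writable (n k : nat) : Prop :=
  exists e : expr, value e = n /\ ones e = k.

Lemma writable_ex (n : nat) : exists k, (0 < n) ==> `[< writable n k >].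
Proof.
case: n => [|n]; first by exists 0.
suff [e ve] : exists e, value e = n.+1.
  by exists (ones e); apply/asboolP; exists e.
elim: n => [|n [e ve]]; first by exists One.
by exists (Add One e); rewrite /= ve.
Qed.

(* Only meaningful for n > 0; the junk value is complexity 0 = 0. *)
Definition complexity (n : nat) : nat := ex_minn (writable_ex n).

Lemma complexity0 : complexity 0 = 0.
Proof. by rewrite /complexity; case: ex_minnP => m _ /(_ 0 isT); case: m. Qed.

Lemma complexity_writable n : 0 < n -> writable n (complexity n).
Proof.
by move=> n0; rewrite /complexity; case: ex_minnP => m; rewrite n0 => /asboolP.
Qed.

Lemma complexity_min n k : writable n k -> complexity n <= k.
Proof.
move=> nk; rewrite /complexity; case: ex_minnP => m _; apply.
by apply/implyP => _; apply/asboolP.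
Qed.

Lemma complexity_le0 k : exists n, complexity n <= k.
Proof. by exists 0; rewrite complexity0. Qed.

Lemma complexity_le_bound k n : complexity n <= k -> n <= 2 ^ k.
Proof.
case: (posnP n) => [-> //|n0 nk].
have [e [ve oe]] := complexity_writable n0.
by rewrite -ve (leq_trans (value_le_expn e))// oe leq_exp2l.
Qed.

(* As complexity 0 = 0, the integer 0 is also a candidate here; it only
   matters for k = 0, where no positive integer is available and
   maxcomplexity 0 = 0. See maxcomplexityP. *)
Definition maxcomplexity (k : nat) : nat :=
  ex_maxn (complexity_le0 k) (@complexity_le_bound k).

Lemma maxcomplexityP k : 0 < k ->
  [/\ 0 < maxcomplexity k, complexity (maxcomplexity k) <= k &
      forall n, 0 < n -> complexity n <= k -> n <= maxcomplexity k].
Proof.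
move=> k0; rewrite /maxcomplexity; case: ex_maxnP => m mk mmax; split => //.
  by apply/mmax/(leq_trans _ k0)/complexity_min; exists One.
by move=> n _; exact: mmax.
Qed.

Definition stable (n : nat) : Prop :=
  0 < n /\
  forall k, 1 <= k -> complexity (3 ^ k * n) = 3 * k + complexity n.

Local Open Scope classical_set_scope.
Local Open Scope ring_scope.

Definition reverse_well_ordered (R : realType) (S : set R) : Prop :=
  forall A : set R, A `<=` S -> A !=set0 ->
    exists2 m, A m & forall x, A x -> x <= m.

(* The ordinal omega^omega in Cantor normal form: c stands for the finite sum
   of the omega^i * c i, taken with decreasing i; two such sums are compared at
   the largest exponent where they differ. *)
Definition omega_omega : set (nat -> nat) :=
  [set c | exists N : nat, forall i, (N <= i)%N -> c i = 0%N].

Definition omega_omega_lt (c d : nat -> nat) : Prop :=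
  exists2 i, (c i < d i)%N & forall j, (i < j)%N -> c j = d j.

Definition has_reverse_order_type_omega_omega (R : realType) (S : set R) : Prop :=
  exists2 f : R -> nat -> nat, set_bij S omega_omega f &
    forall x y, S x -> S y -> (y < x <-> omega_omega_lt (f x) (f y)).

Definition stable_ratios3 (R : realType) (a : nat) : set R :=
  [set n%:R / 3 ^+ (complexity n %/ 3)%N |
     n in [set n | (complexity n = a %[mod 3])%N /\ stable n]].

Definition stable_ratiosE (R : realType) (a : nat) : set R :=
  [set n%:R / (maxcomplexity (complexity n))%:R |
     n in [set n | (complexity n = a %[mod 3])%N /\ stable n]].

Arguments stable_ratios3 : clear implicits.
Arguments stable_ratiosE : clear implicits.

(* Main.v *)
Require Import Defs.
From mathcomp Require Import all_boot all_order all_algebra.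
From mathcomp Require Import boolp classical_sets functions reals.
From mathcomp Require Import zify ring.

(* Write D(n) = 3^||n|| / n^3, the exponential of the defect of n.  For a fixed
   residue of ||n|| mod 3 both ratios of the theorem are decreasing functions of
   D(n), so the order type of the set of values D(n), n stable, is at stake.

   Upper bound.  If n = a + b is an optimal last step with b <= a, then
   D(n) >= 9/8 D(a) unless n <= 3, and b is bounded in terms of D(n); if n = uv is
   an optimal last step, then D(n) = D(u) D(v).  By induction the numbers with
   D(n) <= t lie in finitely many families g(x_1, ..., x_k), built from constants
   and powers 3^(x_i) by products and by adding constants, of complexity
   C + 3 (x_1 + ... + x_k), and along such a family D is nondecreasing in each
   x_i.  So the values of D up to t have order type less than omega^(k+1) for
   some k.

   Lower bound.  The numbers 3^(s_k) + ... + 3^(s_1) + 1 have complexity at most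
   3 s_k + k + 1, the values of D predicted by this bound have order type omega^k,
   and the true complexity misses the bound by at most k + 1.  As omega^k is
   additively indecomposable, the set of values of D contains a copy of omega^k.
   Choose t such that the values up to t contain omega^k but those up to 27t/64
   do not.  Among the n with D(n) <= t, those for which some 3^j q n, with q one
   of 1, 2, 4, has smaller complexity than expected are negligible, since then
   D(3^j q n) <= 81/64 t / 3.  For the remaining n, qn is stable, and the choice
   of q yields every residue of the complexity mod 3. *)

Set Implicit Arguments.
Unset Strict Implicit.
Unset Printing Implicit Defensive.

Import Order.TTheory GRing.Theory Num.Theory.

Local Open Scope classical_set_scope.

(** * Order types below omega^omega *)

(* For a well-order [lt] this says that the order type of [X] is less than
   omega^k; closure under finite unions is built into the definition. *)
Fixpoint thin (T : Type) (lt : T -> T -> Prop) (k : nat) (X : set T) : Prop :=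
  match k with
  | 0 => X `<=` set0
  | k'.+1 => exists m (Y : nat -> set T),
      X `<=` \bigcup_(i in [set i | i < m]) Y i /\
      forall i p, Y i p -> thin lt k' [set q | Y i q /\ lt q p]
  end.

Lemma thin_preimage (T U : Type) (ltT : T -> T -> Prop) (ltU : U -> U -> Prop)
    (f : T -> U) k (X : set T) (Y : set U) :
  (forall x, X x -> Y (f x)) ->
  (forall x y, X x -> X y -> ltT x y -> ltU (f x) (f y)) ->
  thin ltU k Y -> thin ltT k X.
Proof.
elim: k X Y => [|k IH] X Y XY mono /=; first by move=> Y0 x /XY/Y0.
move=> [m [Z [YZ Zthin]]]; exists m, (fun i => X `&` f @^-1` Z i); split.
  by move=> x Xx; have [i im Zi] := YZ _ (XY _ Xx); exists i.
move=> i p [Xp Zp]; apply: IH (Zthin i _ Zp) => [q [[Xq Zq] qp]|q r [[Xq _] _] [[Xr _] _]].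
  by split => //; exact: mono.
exact: mono.
Qed.

Lemma sub_thin (T : Type) (lt : T -> T -> Prop) k (X Y : set T) :
  X `<=` Y -> thin lt k Y -> thin lt k X.
Proof. by move=> XY; apply: (@thin_preimage _ _ _ _ id). Qed.

Lemma thin_set0 (T : Type) (lt : T -> T -> Prop) k : thin lt k set0.
Proof. by case: k => //= k; exists 0, (fun=> set0); split. Qed.

Lemma thin_leq (T : Type) (lt : T -> T -> Prop) k l (X : set T) :
  k <= l -> thin lt k X -> thin lt l X.
Proof.
elim: k l X => [|k IH] l X; first by move=> _ /sub_thin; apply; exact: thin_set0.
case: l => // l kl [m [Y [XY Yt]]]; exists m, Y; split => // i p /Yt; exact: IH.
Qed.

Lemma thinU (T : Type) (lt : T -> T -> Prop) k (X Y : set T) :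
  thin lt k X -> thin lt k Y -> thin lt k (X `|` Y).
Proof.
case: k => [|k] /=; first by move=> X0 Y0 x [/X0|/Y0].
move=> [m [X' [XX' X't]]] [n [Y' [YY' Y't]]].
exists (m + n), (fun i => if i < m then X' i else Y' (i - m)); split; last first.
  by move=> i p; case: ifP => _; [exact: X't|exact: Y't].
move=> x [/XX'|/YY'] [i /= im Zi]; first by exists i => //=; [lia|rewrite im].
by exists (m + i) => /=; [lia|case: ifP; [lia|rewrite addKn]].
Qed.

Lemma thin_bigcup (T : Type) (lt : T -> T -> Prop) k m (Z : nat -> set T) :
  (forall i, i < m -> thin lt k (Z i)) ->
  thin lt k (\bigcup_(i in [set i | i < m]) Z i).
Proof.
elim: m => [|m IH] Zt; first by apply: sub_thin (thin_set0 lt k) => x [].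
apply: (@sub_thin _ _ _ _ ((\bigcup_(i in [set i | i < m]) Z i) `|` Z m)).
  move=> x [i /=]; rewrite ltnS leq_eqVlt => /orP[/eqP->|im] Zx; first by right.
  by left; exists i.
by apply: thinU; [apply: IH => i im; apply: Zt; lia|exact: Zt].
Qed.

(** Induction on [k], then on the number of pieces: inside a piece, the elements below a given [p]
    are thin for a smaller [k]. *)
Lemma thin_min (T : Type) (lt : T -> T -> Prop) k (X A : set T) :
  (forall x y z, lt x y -> lt y z -> lt x z) ->
  thin lt k X -> A `<=` X -> A !=set0 ->
  exists2 m, A m & forall x, A x -> ~ lt x m.
Proof.
move=> tr; elim: k X A => [|k IH] X A /=; first by move=> X0 AX [x /AX/X0].
move=> [m [Y [XY Yt]]] /subset_trans/(_ XY) {X XY}.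
elim: m A => [|m IHm] A AY A0; first by have [x /AY[]] := A0.
(* a minimum of the part of A outside [Y m] competes with one inside [Y m] *)
have [Am|Am] := pselect ((A `&` Y m) !=set0); last first.
  apply: IHm A0 => x Ax; have [i /= im Yx] := AY _ Ax.
  exists i => //=; have [im'|] := ltnP i m; first by [].
  move=> mi; exfalso; apply: Am; exists x; split=> //.
  by have -> : m = i by lia.
have [p [Ap Yp] pmin] : exists2 p, (A `&` Y m) p & forall x, (A `&` Y m) x -> ~ lt x p.
  have [p [Ap Yp]] := Am.
  have [B0|B0] := pselect ((A `&` [set q | Y m q /\ lt q p]) !=set0); last first.
    by exists p => // x [Ax Yx] xp; apply: B0; exists x.
  have [q [Aq [Yq qp]] qmin] := IH _ (A `&` [set q | Y m q /\ lt q p]) (Yt m p Yp) (@subIsetr _ _ _) B0.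
  exists q => // x [Ax Yx] xq; apply: (qmin x) => //; split=> //; split=> //.
  exact: tr xq qp.
have [C0|C0] := pselect ((A `&` [set q | lt q p]) !=set0); last first.
  by exists p => // x Ax xp; apply: C0; exists x.
have [|q [Aq qp] qmin] := IHm (A `&` [set q | lt q p]) _ C0.
  move=> x [Ax xp]; have [i /= im Yx] := AY _ Ax; exists i => //=.
  have [//|mi] := ltnP i m; exfalso; apply: (pmin x) xp; split=> //.
  by have -> : m = i by lia.
by exists q => // x Ax xq; apply: (qmin x) => //; split=> //; exact: tr xq qp.
Qed.

(** As in Dickson's lemma: if [lt q p], then [mono] forbids [p <= q] coordinatewise, so [q i < p i]
    for some [i], which must be in [J]. So [q] lies in one of finitely many slices where this
    coordinate is fixed, each with one free coordinate fewer. *)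
Lemma thin_slices (I : finType) (lt : (I -> nat) -> (I -> nat) -> Prop)
    (J : {set I}) (c : I -> nat) :
  (forall x y, (forall i, x i <= y i) -> ~ lt y x) ->
  thin lt #|J|.+1 [set x | forall i, i \notin J -> x i = c i].
Proof.
move=> mono; have [n] := ubnP #|J|; elim: n J c => // n IH J c Jn.
exists 1, (fun=> [set x | forall i, i \notin J -> x i = c i]); split.
  by move=> x Xx; exists 0.
move=> _ p Xp.
pose Z j : set (I -> nat) := if insub j is Some u then
  \bigcup_(v in [set v | v < p (enum_val (u : 'I_#|J|))])
    [set x | forall i, i \notin J :\ enum_val u -> x i = if i == enum_val u then v else c i]
  else set0.
apply: (@sub_thin _ _ _ _ (\bigcup_(j in [set j | j < #|J|]) Z j)).
  move=> q [Xq qp].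
  have [i qi] : exists i, q i < p i.
    apply: contrapT => nq; apply: (mono p q) => // i; rewrite leqNgt; apply/negP => qi.
    by apply: nq; exists i.
  have iJ : i \in J by apply: contraT => iJ; move: qi; rewrite Xq// Xp// ltnn.
  exists (enum_rank_in iJ i) => /=; first exact: ltn_ord.
  rewrite /Z valK enum_rankK_in//; exists (q i) => //= l.
  by rewrite !inE negb_and negbK; case: eqP => [->|_ /= /Xq].
apply: thin_bigcup => j jJ; rewrite /Z; case: insubP => [u _ _|_]; last exact: thin_set0.
apply: thin_bigcup => v _.
have dJ : #|J| = #|J :\ enum_val u|.+1 by rewrite (cardsD1 (enum_val u) J) enum_valP.
by rewrite dJ; apply: IH; lia.
Qed.

(** * Cantor normal forms below omega^omega *)

Lemma omega_omega_lt_trans c d e :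
  omega_omega_lt c d -> omega_omega_lt d e -> omega_omega_lt c e.
Proof.
move=> [i ci cd] [j dj de]; exists (maxn i j).
  have [ij|ij|ij] := ltngtP i j; first by rewrite cd.
    by rewrite -de.
  by subst j; exact: ltn_trans ci dj.
by move=> l lij; rewrite cd ?de//; lia.
Qed.

Lemma omega_omega_ltxx c : ~ omega_omega_lt c c.
Proof. by move=> [i]; rewrite ltnn. Qed.

Lemma omega_omega_total c d : omega_omega c -> omega_omega d ->
  ~ omega_omega_lt c d -> c = d \/ omega_omega_lt d c.
Proof.
move=> [m cm] [n dn] cd; have [dc|dc] := pselect (omega_omega_lt d c); first by right.
(* Downward induction on [i] from [m + n], from where on both sequences vanish. *)
left; apply/funext => i; have [k ik] : exists k, m + n <= i + k by exists (m + n); lia.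
elim/ltn_ind: k i ik => k IH i ik; have [mni|imn] := leqP (m + n) i.
  by rewrite cm ?dn//; lia.
have ab j : i < j -> c j = d j by move=> ij; apply: (IH (k - (j - i))); lia.
have [lt|lt|//] := ltngtP (c i) (d i); exfalso; first by apply: cd; exists i.
by apply: dc; exists i => // j ij; rewrite ab.
Qed.

(** If [c] vanishes from [n] on, so does every [d] below it; such [d] amount to [n]-tuples, to which
    [thin_slices] applies. *)
Lemma omega_omega_below_thin c : omega_omega c ->
  exists k, thin omega_omega_lt k [set d | omega_omega d /\ omega_omega_lt d c].
Proof.
move=> [n cn]; exists #|[set: 'I_n]%SET|.+1.
pose ext (x : 'I_n -> nat) j := if insub j is Some i then x i else 0.
have extE (d : nat -> nat) : omega_omega_lt d c -> ext (fun i : 'I_n => d i) = d.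
  move=> [i di dc]; apply/funext => j; rewrite /ext; case: insubP => [u _ <-//|nj].
  have [ij|ji] := ltnP i j; first by rewrite dc// cn//; lia.
  by move: di; rewrite cn//; lia.
apply: (@thin_preimage _ _ _ (fun x y => omega_omega_lt (ext x) (ext y))
  (fun (d : nat -> nat) (i : 'I_n) => d i) _ _ [set x | forall i, i \notin [set: 'I_n]%SET -> x i = 0]).
- by move=> d _ i; rewrite inE.
- by move=> x y [_ /extE xE] [_ /extE yE]; rewrite xE yE.
apply: thin_slices => x y xy [i]; rewrite /ext; case: insubP => // u _ _.
by rewrite ltnNge xy.
Qed.

(** The set is a copy of omega^k. If finitely many pieces cover omega^(k+1), then for large [v] each
    piece either misses the slice [c k = v] or has an element above the whole slice; so the slice, a
    copy of omega^k, would be thin for [k]. *)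
Lemma omega_power_not_thin k :
  ~ thin omega_omega_lt k [set c | forall i, k <= i -> c i = 0].
Proof.
elim: k => [|k IH]; first by move=> /(_ (fun=> 0)); exact.
move=> [m [Y [cov Yt]]].
pose V i : set (nat -> nat) := Y i `&` [set c | forall j, k < j -> c j = 0].
pose bounded i v := forall c, V i c -> c k < v.
have [v vP] : exists v, forall i, i < m -> (exists w, bounded i w) -> bounded i v.
  elim: m {cov} => [|m [v vP]]; first by exists 0.
  have [[w wP]|nw] := pselect (exists w, bounded m w).
    exists (maxn v w) => i; rewrite ltnS leq_eqVlt => /orP[/eqP->|/vP/[apply] bv] => [_ c /wP|c /bv]; lia.
  by exists v => i; rewrite ltnS leq_eqVlt => /orP[/eqP->/nw|/vP].
apply: IH; pose up (c : nat -> nat) i := if i == k then v else c i.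
apply: (@thin_preimage _ _ _ omega_omega_lt up _ _
    (\bigcup_(i in [set i | i < m]) [set c | V i c /\ c k = v])).
- move=> c /= ck.
  have upk i : k < i -> up c i = 0.
    by move=> ki; rewrite /up; case: eqP => [|_]; [lia|apply: ck; lia].
  by have [i im Yi] := cov _ upk; exists i => //; split=> //; rewrite /up eqxx.
- move=> c d /= ck dk [i ci cd]; exists i; rewrite /up.
    by case: eqP => // ik; move: ci; rewrite ck ?dk//; lia.
  by move=> j /cd; case: eqP.
apply: thin_bigcup => i im.
have [bi|nbi] := pselect (exists w, bounded i w).
  apply: sub_thin (thin_set0 _ _) => c [Vc cv].
  by have := vP _ im bi _ Vc; rewrite cv ltnn.
have [p [Yp p0] vp] : exists2 p, V i p & v < p k.
  apply: contrapT => np; apply: nbi; exists v.+1 => c Vc; rewrite ltnS leqNgt.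
  by apply/negP => vc; apply: np; exists c.
apply: sub_thin (Yt i p Yp) => c [[Yc c0] ck]; split=> //.
by exists k; [rewrite ck|move=> j kj; rewrite c0 ?p0].
Qed.

Lemma omega_omega_not_thin k : ~ thin omega_omega_lt k omega_omega.
Proof.
by move=> W; apply: (@omega_power_not_thin k); apply: sub_thin W => c ck; exists k.
Qed.

Definition least (A : set (nat -> nat)) : nat -> nat :=
  xget (fun=> 0) [set c | A c /\ forall d, A d -> ~ omega_omega_lt d c].

Lemma leastP (A : set (nat -> nat)) : A `<=` omega_omega -> A !=set0 ->
  A (least A) /\ forall d, A d -> ~ omega_omega_lt d (least A).
Proof.
move=> AW [c Ac]; rewrite /least; case: xgetP => [d _ //|nA]; exfalso.
have [k ck] := omega_omega_below_thin (AW _ Ac).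
have [B0|B0] := pselect ((A `&` [set d | omega_omega d /\ omega_omega_lt d c]) !=set0).
  have [m [Am [_ mc]] mmin] :=
    thin_min omega_omega_lt_trans ck (@subIsetr _ A _) B0.
  apply: (nA m); split=> // d Ad dm; apply: (mmin d) => //.
  split=> //; split; [exact: AW|exact: omega_omega_lt_trans dm mc].
by apply: (nA c); split=> // d Ad dc; apply: B0; exists d; split=> //; split=> //; exact: AW.
Qed.

(** * A criterion for reverse order type omega^omega *)

Lemma reverse_well_ordered_thin (R : realType) (S : set R) :
  (forall x, S x -> exists k,
    thin (fun y z => (z < y)%R) k (S `&` [set y | (x < y)%R])) ->
  reverse_well_ordered S.
Proof.
move=> Sthin A AS [x Ax]; have [k xk] := Sthin _ (AS _ Ax).
have [B0|B0] := pselect ((A `&` [set y | (x < y)%R]) !=set0); last first.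
  by exists x => // y Ay; rewrite leNgt; apply/negP => xy; apply: B0; exists y.
have [||m [Am xm] mmax] := @thin_min _ _ _ _ (A `&` [set y | (x < y)%R]) _ xk _ B0.
- by move=> u v w vu wv; exact: lt_trans wv vu.
- by move=> y [/AS].
exists m => // y Ay; rewrite leNgt; apply/negP => my; apply: (mmax y) => //.
by split=> //=; exact: lt_trans my.
Qed.

(** Mostowski collapse: going down in [S], [f x] is the least normal form above all earlier values.
    Since upper parts of [S] are thin, the values never run out; since [S] is not, every form is
    reached. *)
Lemma reverse_order_type_omega_omega_thin (R : realType) (S : set R) :
  (forall x, S x -> exists k,
    thin (fun y z => (z < y)%R) k (S `&` [set y | (x < y)%R])) ->
  (forall k, ~ thin (fun y z : R => (z < y)%R) k S) ->
  has_reverse_order_type_omega_omega S.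
Proof.
move=> Sthin Sfat; have Swo := reverse_well_ordered_thin Sthin.
pose rel (y x : R) := S y /\ (x < y)%R.
have wf : well_founded rel.
  have accS y : S y -> Acc rel y.
    move=> Sy; apply: contrapT => nacc.
    have [||m [Sm nm] mmax] := Swo [set z | S z /\ ~ Acc rel z].
    - by move=> z [].
    - by exists y.
    apply: nm; constructor => z [Sz mz]; apply: contrapT => nz.
    by have := mmax z (conj Sz nz); rewrite leNgt mz.
  by move=> x; constructor => y [/accS].
pose above (x : R) (g : forall y, rel y x -> nat -> nat) : set (nat -> nat) :=
  [set c | omega_omega c /\ forall y (yx : rel y x), omega_omega_lt (g y yx) c].
pose f := Fix wf (fun=> nat -> nat) (fun x g => least (@above x g)).
pose B x := [set c | omega_omega c /\ forall y, S y -> (x < y)%R -> omega_omega_lt (f y) c].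
have fE x : f x = least (B x).
  rewrite /f Fix_eq -/f => [|{}x g h gh]; last first.
    by congr (least (above _ _)); apply/functional_extensionality_dep => y; apply/funext => p.
  congr least; apply/seteqP; split=> c [Wc cP]; split=> // y.
    by move=> Sy xy; exact: (cP y (conj Sy xy)).
  by move=> [Sy xy]; exact: cP.
have BP x : B x !=set0 -> B x (f x) /\ forall d, B x d -> ~ omega_omega_lt d (f x).
  by move=> B0; rewrite fE; apply: leastP B0 => c [].
(* the values of [f] form an initial segment *)
have down x c : S x -> (forall y, S y -> (x <= y)%R -> B y !=set0) ->
    omega_omega c -> ~ omega_omega_lt (f x) c ->
    exists y, [/\ S y, (x <= y)%R & f y = c].
  elim/(well_founded_ind wf): x => x IH Sx xB Wc fxc.
  have [[Wfx fxP] fxmin] := BP x (xB x Sx (lexx x)).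
  have [fc|cfx] := omega_omega_total Wfx Wc fxc; first by exists x.
  have [y [Sy xy fyc]] : exists y, [/\ S y, (x < y)%R & ~ omega_omega_lt (f y) c].
    apply: contrapT => ny; apply: (fxmin c) => //; split=> // y Sy xy.
    by apply: contrapT => fyc; apply: ny; exists y.
  have [|z [Sz yz fz]] := IH y (conj Sy xy) Sy _ Wc fyc.
    by move=> z Sz yz; apply: xB => //; exact: le_trans (ltW xy) yz.
  by exists z; split=> //; exact: le_trans (ltW xy) yz.
(* Were the values above [x] unbounded, they would exhaust omega^omega by [down], and a right
   inverse of [f] would embed omega^omega into a thin set. *)
have B0 x : S x -> B x !=set0.
  elim/(well_founded_ind wf): x => x IH Sx; apply: contrapT => nB.
  have [k /thin_preimage xk] := Sthin _ Sx.
  have /choice[h hP] c : exists y, omega_omega c -> [/\ S y, (x < y)%R & f y = c].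
    have [Wc|//] := pselect (omega_omega c); last by exists x.
    have [y [Sy xy fyc]] : exists y, [/\ S y, (x < y)%R & ~ omega_omega_lt (f y) c].
      apply: contrapT => ny; apply: nB; exists c; split=> // y Sy xy.
      by apply: contrapT => fyc; apply: ny; exists y.
    have [z Sz yz|z [Sz yz fz]] := down y c Sy _ Wc fyc.
      by apply: IH => //; split=> //; exact: lt_le_trans yz.
    by exists z => _; split=> //; exact: lt_le_trans yz.
  apply: (@omega_omega_not_thin k); apply: (xk _ _ h) => [c /hP[]//|c d Wc Wd cd].
  have [Sc xc fc] := hP _ Wc; have [Sd xd fd] := hP _ Wd.
  rewrite ltNge; apply/negP; rewrite le_eqVlt => /orP[/eqP hcd|hcd].
    by move: cd; rewrite -fc hcd fd; exact: omega_omega_ltxx.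
  have [[_ /(_ _ Sd hcd) dc] _] := BP _ (IH _ (conj Sc xc) Sc).
  by move: dc; rewrite fc fd => /(omega_omega_lt_trans cd)/omega_omega_ltxx.
have mono x y : S x -> S y -> (y < x)%R -> omega_omega_lt (f x) (f y).
  by move=> Sx Sy yx; have [[_ +] _] := BP _ (B0 _ Sy); exact.
have W x : S x -> omega_omega (f x) by move=> /B0/BP[[]].
have monoE x y : S x -> S y -> (y < x)%R <-> omega_omega_lt (f x) (f y).
  move=> Sx Sy; split; first exact: mono.
  move=> fxy; rewrite ltNge; apply/negP; rewrite le_eqVlt => /orP[/eqP xy|].
    by move: fxy; rewrite xy; exact: omega_omega_ltxx.
  by move=> /(mono _ _ Sy Sx)/(omega_omega_lt_trans fxy)/omega_omega_ltxx.
exists f => //; split.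
- exact: W.
- move=> x y; rewrite !inE => Sx Sy fxy.
  have [xy|yx|//] := ltgtP x y.
    by have := mono _ _ Sy Sx xy; rewrite fxy => /omega_omega_ltxx.
  by have := mono _ _ Sx Sy yx; rewrite fxy => /omega_omega_ltxx.
(* If [c] were omitted, all values would lie below [c] by [down], and [S] would be thin. *)
move=> c Wc; apply: contrapT => nc.
have [k ck] := omega_omega_below_thin Wc.
apply: (Sfat k); apply: thin_preimage ck => [x Sx|x y]; last exact: mono.
split; first exact: W.
apply: contrapT => fxc; have [y Sy _|y [Sy _ fy]] := down x c Sx _ Wc fxc.
  exact: B0.
by apply: nc; exists y.
Qed.

(** * Integer complexity *)

(** The closed form of E(k) for k > 0, see [maxcomplexityE]; the value at 0 is a default. The
    recursion starts at 5 because E(4) = 4 exceeds 3 E(1). *)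
Fixpoint maxvalue (k : nat) : nat :=
  match k with
  | 0 | 1 => 1
  | 2 => 2
  | 3 => 3
  | 4 => 4
  | k'.+3 => 3 * maxvalue k'
  end.

Lemma maxvalueD3 k : 1 < k -> maxvalue (k + 3) = 3 * maxvalue k.
Proof. by move=> k1; rewrite addn3; case: k k1 => [|[|]]. Qed.

Lemma maxvalue_gt0 k : 0 < maxvalue k.
Proof.
elim/ltn_ind: k => k IH; have [k4|k5] := leqP k 4.
  by case: k k4 {IH} => [|[|[|[|[|]]]]].
have [j jk] : exists j, k = j + 3 by exists (k - 3); lia.
by subst k; rewrite maxvalueD3 ?muln_gt0 ?IH//; lia.
Qed.

(** Induction takes 3 off the larger argument, down to the finitely many cases with both at most
    4. *)
Lemma maxvalue_leqD x y : 0 < x -> 0 < y ->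
  maxvalue x + maxvalue y <= maxvalue (x + y) /\
  maxvalue x * maxvalue y <= maxvalue (x + y).
Proof.
have [n] := ubnP (x + y); elim: n x y => // n IH.
suff step x y : y <= x -> x + y < n.+1 -> 0 < x -> 0 < y ->
    maxvalue x + maxvalue y <= maxvalue (x + y) /\
    maxvalue x * maxvalue y <= maxvalue (x + y).
  move=> x y xyn x0 y0; have [yx|/ltnW xy] := leqP y x; first exact: step.
  by rewrite addnC mulnC (addnC x y); apply: step => //; rewrite addnC.
move=> yx xyn x0 y0; have [x4|x5] := leqP x 4.
  have y4 := leq_trans yx x4; case: x y x0 y0 x4 y4 {IH yx xyn}
    => [|[|[|[|[|]]]]] // [|[|[|[|[|]]]]] //.
have [z xz] : exists z, x = z + 3 by exists (x - 3); lia.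
subst x; have [||//|h1 h2] := IH z y; [lia|lia|].
rewrite addnAC !maxvalueD3; [|lia|lia]; split; first lia.
by rewrite -mulnA leq_mul2l h2.
Qed.

Lemma value_le_maxvalue e : value e <= maxvalue (ones e).
Proof.
elim: e => //= e1 h1 e2 h2.
  have [+ _] := maxvalue_leqD (ones_gt0 e1) (ones_gt0 e2); lia.
have [_ +] := maxvalue_leqD (ones_gt0 e1) (ones_gt0 e2).
by apply: leq_trans; exact: leq_mul.
Qed.

Lemma maxvalue_cube k : maxvalue k ^ 3 <= 3 ^ k.
Proof.
elim/ltn_ind: k => k IH; have [k4|k5] := leqP k 4.
  by case: k k4 {IH} => [|[|[|[|[|]]]]].
have [j jk] : exists j, k = j + 3 by exists (k - 3); lia.
subst k; rewrite maxvalueD3 ?expnMn; last lia.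
by rewrite expnD mulnC leq_mul2r IH ?orbT//; lia.
Qed.

Lemma le_maxvalue n : 0 < n -> n <= maxvalue (complexity n).
Proof. by move=> /complexity_writable[e [<- <-]]; exact: value_le_maxvalue. Qed.

(** That is, D(n) >= 1. *)
Lemma cube_le_complexity n : 0 < n -> n ^ 3 <= 3 ^ complexity n.
Proof.
by move=> n0; apply: leq_trans (maxvalue_cube _); rewrite leq_exp2r// le_maxvalue.
Qed.

Lemma complexity_gt0 n : 0 < n -> 0 < complexity n.
Proof. by move=> /complexity_writable[e [_ <-]]; exact: ones_gt0. Qed.

Lemma complexityD m n : 0 < m -> 0 < n ->
  complexity (m + n) <= complexity m + complexity n.
Proof.
move=> /complexity_writable[e [em eo]] /complexity_writable[f [fn fo]].
by apply: complexity_min; exists (Add e f); rewrite /= em eo fn fo.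
Qed.

Lemma complexityM m n : 0 < m -> 0 < n ->
  complexity (m * n) <= complexity m + complexity n.
Proof.
move=> /complexity_writable[e [em eo]] /complexity_writable[f [fn fo]].
by apply: complexity_min; exists (Mul e f); rewrite /= em eo fn fo.
Qed.

Lemma complexity1 : complexity 1 = 1.
Proof.
by apply/eqP; rewrite eqn_leq complexity_gt0// andbT; apply: complexity_min; exists One.
Qed.

Lemma complexity_eq1 n : 0 < n -> complexity n = 1 -> n = 1.
Proof. by move=> n0 n1; have := le_maxvalue n0; rewrite n1 /=; lia. Qed.

Lemma complexity2 : complexity 2 = 2.
Proof.
apply/eqP; rewrite eqn_leq; apply/andP; split.
  by have := @complexityD 1 1 isT isT; rewrite complexity1.
have := @cube_le_complexity 2 isT; have := @complexity_gt0 2 isT.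
by case: (complexity 2) => [|[|]].
Qed.

Lemma complexity3 : complexity 3 = 3.
Proof.
apply/eqP; rewrite eqn_leq; apply/andP; split.
  by have := @complexityD 1 2 isT isT; rewrite complexity1 complexity2.
have := @cube_le_complexity 3 isT; have := @complexity_gt0 3 isT.
by case: (complexity 3) => [|[|[|]]].
Qed.

Lemma complexity_exp3M k n : 0 < n -> complexity (3 ^ k * n) <= 3 * k + complexity n.
Proof.
move=> n0; elim: k => [|k IH]; first by rewrite mul1n.
rewrite expnS -mulnA; apply: leq_trans (complexityM _ _) _ => //.
  by rewrite muln_gt0 expn_gt0.
by rewrite complexity3; lia.
Qed.

Lemma complexity_maxvalue k : 0 < k -> complexity (maxvalue k) <= k.
Proof.
elim/ltn_ind: k => k IH k0; have [k4|k5] := leqP k 4.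
  case: k k0 k4 {IH} => [|[|[|[|[|]]]]] //= _ _.
  - by rewrite complexity1.
  - by rewrite complexity2.
  - by rewrite complexity3.
  - by have := @complexityM 2 2 isT isT; rewrite complexity2.
have [j jk] : exists j, k = j + 3 by exists (k - 3); lia.
subst k; rewrite maxvalueD3; last lia.
have := @complexity_exp3M 1 (maxvalue j).
have : complexity (maxvalue j) <= j by apply: IH; lia.
rewrite expn1; have := maxvalue_gt0 j; lia.
Qed.

Lemma maxcomplexityE k : 0 < k -> maxcomplexity k = maxvalue k.
Proof.
move=> k0; have [m0 mk mmax] := maxcomplexityP k0.
have maxvalue_homo i j : 0 < i -> i <= j -> maxvalue i <= maxvalue j.
  move=> i0; rewrite leq_eqVlt => /orP[/eqP->//|ij].
  have ji0 : 0 < j - i by lia.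
  have [+ _] := maxvalue_leqD i0 ji0; have -> : i + (j - i) = j by lia.
  lia.
apply/eqP; rewrite eqn_leq; apply/andP; split.
  apply: leq_trans (le_maxvalue m0) _; apply: maxvalue_homo => //.
  exact: complexity_gt0.
apply: mmax; last exact: complexity_maxvalue.
by apply: leq_trans (maxvalue_homo 1 k isT k0).
Qed.

(** E(k) is 3^floor(k/3) times 1, 4/3 or 2; tripling keeps this integral. Hence the two ratios
    differ by a constant factor on each residue class. *)
Lemma maxvalue_exp3 k : 1 < k ->
  3 * maxvalue k = 3 ^ (k %/ 3) * nth 0 [:: 3; 4; 6] (k %% 3).
Proof.
elim/ltn_ind: k => k IH k1; have [k4|k5] := leqP k 4.
  by case: k k1 k4 {IH} => [|[|[|[|[|]]]]].
have [j jk] : exists j, k = j + 3 by exists (k - 3); lia.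
subst k; rewrite maxvalueD3; last lia.
rewrite IH; [|lia|lia].
by rewrite divnDr// modnDr divnn expnD expn1 mulnA [3 * _]mulnC.
Qed.

(** The cases are the last operation of an optimal expression, whose operands are then optimal too;
    a factor 1 would waste a 1. *)
Lemma complexity_cases n : 0 < n ->
  [\/ n = 1,
      exists u v, [/\ 1 < u, 1 < v, n = u * v &
        complexity n = complexity u + complexity v] |
      exists a b, [/\ 0 < b, b <= a, n = a + b &
        complexity n = complexity a + complexity b]].
Proof.
move=> n0; have [e [en ec]] := complexity_writable n0.
case: e en ec => [<- _|e f en ec|e f en ec]; first by constructor 1.
- constructor 3.
  have [e0 f0] := (value_gt0 e, value_gt0 f).
  have ce : complexity (value e) <= ones e by apply: complexity_min; exists e.
  have cf : complexity (value f) <= ones f by apply: complexity_min; exists f.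
  have := complexityD e0 f0; move: en ec => /= en ec; rewrite en => cn.
  have [ef|fe] := leqP (value e) (value f).
    by exists (value f), (value e); split=> //; lia.
  by exists (value e), (value f); split=> //; lia.
- constructor 2.
  have [e0 f0] := (value_gt0 e, value_gt0 f).
  have ce : complexity (value e) <= ones e by apply: complexity_min; exists e.
  have cf : complexity (value f) <= ones f by apply: complexity_min; exists f.
  have := complexityM e0 f0; move: en ec => /= en ec; rewrite en => cn.
  have [oe of'] := (ones_gt0 e, ones_gt0 f).
  exists (value e), (value f); split=> //; last lia.
    rewrite ltn_neqAle e0 andbT; apply/eqP => e1; move: en; rewrite -e1 mul1n => fn.
    by move: cf; rewrite fn; lia.
  rewrite ltn_neqAle f0 andbT; apply/eqP => f1; move: en; rewrite -f1 muln1 => fn.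
  by move: ce; rewrite fn; lia.
Qed.

(** For an optimal sum this reads D(a + b) >= 9/8 D(a). If ||b|| >= 2, use a + b <= 2a and 9 <=
    3^||b||; if b = 1, then a >= 3 and a + 1 <= 4a/3. *)
Lemma sum_defect_gain a b : 0 < b -> b <= a -> 3 < a + b ->
  9 * (a + b) ^ 3 <= 8 * 3 ^ complexity b * a ^ 3.
Proof.
move=> b0 ba ab; have [b1|b1] := leqP 2 (complexity b).
  have h : (a + b) ^ 3 <= (2 * a) ^ 3 by rewrite leq_exp2r//; lia.
  have h' : 9 <= 3 ^ complexity b by rewrite (@leq_exp2l 3 2).
  move: h; rewrite expnMn => h; apply: leq_trans (leq_mul (leqnn 9) h) _.
  by rewrite mulnA leq_mul2r mulnC leq_mul2l/= h' orbT.
have b1' : b = 1 by apply: complexity_eq1 => //; have := complexity_gt0 b0; lia.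
subst b; rewrite complexity1 expn1.
have : (3 * (a + 1)) ^ 3 <= (4 * a) ^ 3 by rewrite leq_exp2r//; lia.
by rewrite !expnMn; lia.
Qed.

(** * Numbers of small defect *)

(** D(m) < D(n) with denominators cleared. *)
Definition defect_lt (m n : nat) : Prop :=
  3 ^ complexity m * n ^ 3 < 3 ^ complexity n * m ^ 3.

Definition ratio_antitone (I : finType) (g : (I -> nat) -> nat) : Prop :=
  forall x y, (forall i, x i <= y i) ->
    g y * 3 ^ (\sum_i x i) <= g x * 3 ^ (\sum_i y i).

(* A set of pairs (n, c) is covered if it lies in a finite union of families
   {(g x, C + 3 |x|)} with [g x / 3 ^ |x|] nonincreasing in [x]. *)
Inductive covered : (nat -> nat -> Prop) -> Prop :=
  | covered_family (I : finType) C (g : (I -> nat) -> nat) : ratio_antitone g ->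
      covered (fun n c => exists2 x, n = g x & c = C + 3 * \sum_i x i)
  | coveredU P Q : covered P -> covered Q -> covered (fun n c => P n c \/ Q n c)
  | sub_covered (P Q : nat -> nat -> Prop) :
      (forall n c, P n c -> Q n c) -> covered Q -> covered P.

(** Along a family D does not decrease when the parameters grow, as [thin_slices] requires; a chosen
    parameter vector [h n] carries the order over. *)
Lemma covered_thin P : covered P ->
  exists k, thin defect_lt k [set n | P n (complexity n)].
Proof.
elim=> {P} [I C g gP|P Q _ [k Pk] _ [l Ql]|P Q PQ _ [k Qk]]; last first.
- by exists k; apply: sub_thin Qk => n /=; exact: PQ.
- exists (k + l); apply: thinU.
    by apply: thin_leq Pk; lia.
  by apply: thin_leq Ql; lia.
exists #|[set: I]%SET|.+1.
have /choice[h hP] n : exists x : I -> nat,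
    (exists2 x, n = g x & complexity n = C + 3 * \sum_i x i) ->
    n = g x /\ complexity n = C + 3 * \sum_i x i.
  have [[x nx cx]|nn] := pselect (exists2 x, n = g x & complexity n = C + 3 * \sum_i x i).
    by exists x.
  by exists (fun=> 0) => /nn.
apply: (@thin_preimage _ _ _ (fun x y : I -> nat =>
    3 ^ (C + 3 * \sum_i x i) * g y ^ 3 < 3 ^ (C + 3 * \sum_i y i) * g x ^ 3)
  h _ _ [set x | forall i, i \notin [set: I]%SET -> x i = 0]).
- by move=> n _ i; rewrite inE.
- move=> m n /hP[mE cm] /hP[nE cn]; rewrite /defect_lt.
  by rewrite cm cn -nE -mE.
apply: thin_slices => x y /gP xy; apply/negP; rewrite -leqNgt !(expnD 3 C) -!mulnA leq_mul2l.
apply/orP; right; rewrite !(mulnC 3) !expnM -!expnMn leq_exp2r//.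
by rewrite mulnC [X in _ <= X]mulnC.
Qed.

Lemma covered1 n c : covered (fun m d => m = n /\ d = c).
Proof.
apply: (@sub_covered _ (fun m d => exists2 x : 'I_0 -> nat, m = n & d = c + 3 * \sum_i x i)).
  by move=> m d [-> ->]; exists (fun=> 0) => //; rewrite big_ord0; lia.
by apply: covered_family => x y xy; rewrite !big_ord0.
Qed.

Lemma covered_exp3 : covered (fun n c => exists2 j, n = 3 ^ j & c = 3 * j).
Proof.
apply: (@sub_covered _ (fun m d => exists2 x : 'I_1 -> nat, m = 3 ^ x ord0 & d = 0 + 3 * \sum_i x i)).
  by move=> m d [j -> ->]; exists (fun=> j) => //; rewrite big_ord1.
by apply: covered_family => x y xy; rewrite !big_ord1 mulnC.
Qed.

Lemma covered_add P b c : covered P ->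
  covered (fun n d => exists n' d', [/\ P n' d', n = n' + b & d = d' + c]).
Proof.
elim=> {P} [I C g gP|P Q _ Pc _ Qc|P Q PQ _ Qc].
- apply: (@sub_covered _ (fun m d => exists2 x : I -> nat, m = g x + b & d = C + c + 3 * \sum_i x i)).
    by move=> m d [_ [_ [[x -> ->] -> ->]]]; exists x => //; lia.
  apply: covered_family => x y xy; have := gP x y xy.
  have : 3 ^ (\sum_i x i) <= 3 ^ (\sum_i y i).
    by rewrite leq_exp2l//; apply: leq_sum => i _; exact: xy.
  by rewrite !mulnDl => h h'; apply: leq_add => //; rewrite leq_mul2l h orbT.
- apply: sub_covered (coveredU Pc Qc) => n d [n' [d' [[Pn|Qn] -> ->]]].
    by left; exists n', d'.
  by right; exists n', d'.
- by apply: sub_covered Qc => n d [n' [d' [/PQ Pn -> ->]]]; exists n', d'.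
Qed.

Lemma covered_mul P Q : covered P -> covered Q ->
  covered (fun n d => exists m c m' c',
    [/\ P m c, Q m' c', n = m * m' & d = c + c']).
Proof.
move=> Pc Qc; elim: Pc => {P} [I C g gP|P P' _ Pc _ P'c|P P' PP' _ P'c]; last first.
- by apply: sub_covered P'c => n d [m [c [m' [c' [/PP' Pm Qm -> ->]]]]]; exists m, c, m', c'.
- apply: sub_covered (coveredU Pc P'c) => n d [m [c [m' [c' [[Pm|Pm] Qm -> ->]]]]].
    by left; exists m, c, m', c'.
  by right; exists m, c, m', c'.
elim: Qc => {Q} [J D h hP|Q Q' _ Qc _ Q'c|Q Q' QQ' _ Q'c]; last first.
- by apply: sub_covered Q'c => n d [m [c [m' [c' [Pm /QQ' Qm -> ->]]]]]; exists m, c, m', c'.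
- apply: sub_covered (coveredU Qc Q'c) => n d [m [c [m' [c' [Pm [Qm|Qm] -> ->]]]]].
    by left; exists m, c, m', c'.
  by right; exists m, c, m', c'.
pose gh (x : I + J -> nat) := g (fun i => x (inl i)) * h (fun j => x (inr j)).
apply: (@sub_covered _ (fun n d => exists2 x : (I + J)%type -> nat, n = gh x &
    d = C + D + 3 * \sum_i x i)).
  move=> _ _ [_ [_ [_ [_ [[x -> ->] [y -> ->] -> ->]]]]].
  exists (fun s => match s with inl i => x i | inr j => y j end) => //.
  by rewrite big_sumType /=; lia.
apply: covered_family => x y xy; rewrite !big_sumType/= !expnD.
by rewrite mulnACA [X in _ <= X]mulnACA; apply: leq_mul; [exact: gP|exact: hP].
Qed.

Lemma covered_bigcup m (P : nat -> nat -> nat -> Prop) :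
  (forall i, i < m -> covered (P i)) ->
  covered (fun n c => exists2 i, i < m & P i n c).
Proof.
elim: m => [|m IH] Pc.
  by apply: sub_covered (covered1 0 0) => n c [].
have IH' : covered (fun n c => exists2 i, i < m & P i n c).
  by apply: IH => i im; apply: Pc; lia.
apply: sub_covered (coveredU IH' (Pc m (ltnSn m))) => n c [i].
by rewrite ltnS leq_eqVlt => /orP[/eqP->|im] Pi; [right|left; exists i].
Qed.

(* D(n) < (9/8)^m *)
Definition low_defect m n c : Prop :=
  [/\ 0 < n, c = complexity n & 8 ^ m * 3 ^ c < 9 ^ m * n ^ 3].

(** The cases 1 and 2 are separate because [sum_defect_gain] does not reach them; 3 counts as a
    power of 3. *)
Definition small_sum m n c : Prop :=
  [\/ n = 1 /\ c = 1, n = 2 /\ c = 2 |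
      exists2 b, b < 8 * 9 ^ m.+1 & exists a d,
        [/\ low_defect m a d, n = a + b & c = d + complexity b]].

(** At cost 3j, the power 3^j contributes the factor 1 to D and is not counted in [l], so that a
    bound on D can bound [l]. *)
Fixpoint small_product m l n c : Prop :=
  match l with
  | 0 => exists2 j, n = 3 ^ j & c = 3 * j
  | l'.+1 => exists u d v e,
      [/\ small_product m l' u d, small_sum m v e, n = u * v & c = d + e]
  end.

Lemma small_productM m l l' n n' c c' :
  small_product m l n c -> small_product m l' n' c' ->
  small_product m (l + l') (n * n') (c + c').
Proof.
move=> nP; elim: l' n' c' => [|l' IH] n' c'; last first.
  move=> [u [d [v [e [uP vP -> ->]]]]]; rewrite addnS.
  by exists (n * u), (c + d), v, e; split; [exact: IH| |rewrite mulnA|rewrite addnA].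
move=> [j -> ->]; rewrite addn0; elim: l n c nP => [|l IH] n c.
  by move=> [i -> ->]; exists (i + j); [rewrite expnD|lia].
move=> [u [d [v [e [uP vP -> ->]]]]].
by exists (u * 3 ^ j), (d + 3 * j), v, e; split; [exact: IH| |lia|lia].
Qed.

Lemma small_sum_small_product m n c : small_sum m n c -> small_product m 1 n c.
Proof. by move=> nP; exists 1, 0, n, c; split; rewrite ?mul1n//; exists 0. Qed.

(** Induction on the last operation: the factors of a product inherit the bound, as D >= 1, and in a
    sum the larger summand gains 9/8. Each factor counted by [l] contributes at least 9/8 to D, with
    equality for 2; this gives the second conclusion. *)
Lemma low_defect_small_product m n : low_defect m.+1 n (complexity n) ->
  exists2 l, small_product m l n (complexity n) &
    9 ^ l * n ^ 3 <= 8 ^ l * 3 ^ complexity n.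
Proof.
elim/ltn_ind: n => n IH [n0 _ nlow].
have [n1|[u [v [u1 v1 nuv cuv]]]|[a [b [b0 ba nab cab]]]] := complexity_cases n0.
- exists 1; last by rewrite n1 complexity1.
  by apply: small_sum_small_product; constructor 1; rewrite n1 complexity1.
- have [u0 v0] : 0 < u /\ 0 < v by lia.
  have [cu cv] := (cube_le_complexity u0, cube_le_complexity v0).
  move: nlow; rewrite cuv nuv expnD expnMn => nlow.
  have [||l lu lu'] := IH u.
  + by rewrite nuv -{1}(muln1 u) ltn_mul2l u0.
  + split=> //; rewrite -(@ltn_pmul2r (3 ^ complexity v)) ?expn_gt0// -mulnA.
    apply: leq_trans nlow _; rewrite -mulnA !leq_mul2l.
    by apply/orP; right; apply/orP; right.
  have [||l' lv lv'] := IH v.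
  + by rewrite nuv -{1}(mul1n v) ltn_mul2r v0.
  + split=> //; rewrite -(@ltn_pmul2r (3 ^ complexity u)) ?expn_gt0// -mulnA.
    rewrite [X in _ * X < _]mulnC; apply: leq_trans nlow _.
    by rewrite -mulnA leq_mul2l [X in X <= _]mulnC leq_mul2l cu !orbT.
  exists (l + l'); first exact: small_productM.
  by rewrite !(expnD _ l l') mulnACA [X in _ <= X]mulnACA; exact: leq_mul.
have a0 : 0 < a by lia.
have ca := cube_le_complexity a0; have cb := cube_le_complexity b0.
have [n3|n3] := leqP n 3.
  have [n2|n3'] : n = 2 \/ n = 3 by lia.
    exists 1; last by rewrite n2 complexity2.
    by apply: small_sum_small_product; constructor 2; rewrite n2 complexity2.
  exists 0; last by rewrite n3' complexity3.
  by exists 1; rewrite n3' ?complexity3.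
have gain : 9 * n ^ 3 <= 8 * 3 ^ complexity b * a ^ 3.
  by rewrite nab; apply: sum_defect_gain => //; lia.
exists 1; last first.
  rewrite !expn1; apply: leq_trans gain _; rewrite cab expnD -mulnA leq_mul2l/= mulnC.
  by rewrite leq_mul2r ca orbT.
move: nlow; rewrite cab expnD => nlow.
apply: small_sum_small_product; constructor 3; exists b; last first.
  exists a, (complexity a); split=> //; split=> //.
  rewrite -(@ltn_pmul2r (8 * 3 ^ complexity b)) ?muln_gt0 ?expn_gt0//.
  apply: (@leq_trans (9 ^ m * (9 * n ^ 3))); last by rewrite -mulnA leq_mul2l (mulnC (a ^ 3)) gain orbT.
  move: nlow; rewrite !expnSr -!mulnA; congr (_ < _); congr (_ * _).
  by rewrite mulnCA.
(* [3 ^ ||b|| <= 8 * 3 ^ (defect of n)] because the defect of [a] is nonnegative *)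
apply: (@leq_ltn_trans (b ^ 3)); first by rewrite -{1}(expn1 b) leq_pexp2l.
apply: leq_ltn_trans cb _.
rewrite -(@ltn_pmul2r (3 ^ complexity a)) ?expn_gt0//.
apply: (@leq_ltn_trans (8 ^ m.+1 * (3 ^ complexity a * 3 ^ complexity b))).
  by rewrite [X in X <= _]mulnC leq_pmull// expn_gt0.
apply: leq_trans nlow _.
rewrite -mulnA [X in _ <= X]mulnCA leq_mul2l; apply/orP; right.
apply: (@leq_trans ((2 * a) ^ 3)); first by rewrite leq_exp2r//; lia.
by rewrite expnMn leq_mul2l ca.
Qed.

(** Induction on [m]: sums lead back to [m], and D(n) >= (9/8)^l leaves only [l <= m] factors. For
    [m = 0] the set is empty. *)
Lemma covered_low_defect m : covered (low_defect m).
Proof.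
elim: m => [|m IH].
  apply: sub_covered (covered1 0 0) => n c [n0 ->].
  by rewrite !mul1n ltnNge cube_le_complexity.
have sum_cov : covered (small_sum m).
  apply: sub_covered (coveredU (covered1 1 1) (coveredU (covered1 2 2)
    (covered_bigcup (fun b (_ : b < 8 * 9 ^ m.+1) => covered_add b (complexity b) IH)))).
  by move=> n c [n1|n2|[b bm nb]]; [left|right; left|right; right; exists b].
have prod_cov l : covered (small_product m l).
  elim: l => [|l IHl]; first exact: covered_exp3.
  exact: covered_mul.
apply: sub_covered (covered_bigcup (fun l (_ : l < m.+1) => prod_cov l)) => n c [n0 -> nlow].
have [l lP nl] : exists2 l, small_product m l n (complexity n) &
    9 ^ l * n ^ 3 <= 8 ^ l * 3 ^ complexity n by exact: low_defect_small_product.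
exists l => //; rewrite ltnNge; apply/negP => ml.
have le89 : 8 ^ (l - m.+1) <= 9 ^ (l - m.+1) by case: (l - m.+1) => // k; rewrite leq_exp2r.
have : 8 ^ l * 3 ^ complexity n < 9 ^ l * n ^ 3.
  rewrite -(subnK ml) !expnD -!mulnA.
  apply: (@leq_ltn_trans (9 ^ (l - m.+1) * (8 ^ m.+1 * 3 ^ complexity n))).
    by rewrite leq_mul2r le89 orbT.
  by rewrite ltn_mul2l expn_gt0.
by rewrite ltnNge nl.
Qed.

(** Bernoulli's inequality for (1 + 1/8)^m. *)
Lemma exp8_leq_exp9 m : (8 + m) * 8 ^ m <= 8 * 9 ^ m.
Proof. by elim: m => // m; rewrite !expnS; nia. Qed.

Lemma defect_below_thin n : 0 < n ->
  exists k, thin defect_lt k [set m | 0 < m /\ defect_lt m n].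
Proof.
move=> n0; pose e := 8 * 3 ^ complexity n.
have [k kP] := covered_thin (covered_low_defect e).
exists k; apply: sub_thin kP => m [m0]; rewrite /defect_lt /low_defect => mn; split=> //.
have h : 8 ^ e * 3 ^ complexity n <= 9 ^ e by have := exp8_leq_exp9 e; rewrite {1}/e; nia.
apply: (@leq_trans (8 ^ e * 3 ^ complexity n * m ^ 3)); last by rewrite leq_mul2r h orbT.
rewrite -mulnA ltn_mul2l expn_gt0 /=; apply: leq_ltn_trans mn.
by rewrite leq_pmulr// expn_gt0 n0.
Qed.

(** * Stable numbers *)

(** [c] lists the gaps between successive exponents, less 1, so that every [c] gives strictly
    increasing exponents. *)
Definition tower_exp k (c : nat -> nat) : nat := \sum_(i < k) (c i).+1.

Definition tower k (c : nat -> nat) : nat := \sum_(i < k.+1) 3 ^ tower_exp i c.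

Lemma tower_expS k c : tower_exp k.+1 c = tower_exp k c + (c k).+1.
Proof. by rewrite /tower_exp big_ord_recr. Qed.

Lemma towerS k c : tower k.+1 c = tower k c + 3 ^ tower_exp k.+1 c.
Proof. by rewrite /tower big_ord_recr. Qed.

Lemma tower0 c : tower 0 c = 1.
Proof. by rewrite /tower big_ord1 /tower_exp big_ord0. Qed.

Lemma tower_bounds k c :
  3 ^ tower_exp k c <= tower k c /\ 2 * tower k c < 3 * 3 ^ tower_exp k c.
Proof.
elim: k => [|k [_ IH]]; first by rewrite tower0 /tower_exp big_ord0.
rewrite towerS tower_expS expnD expnS; split; first lia.
have : 0 < 3 ^ c k by rewrite expn_gt0.
nia.
Qed.

(** Horner's scheme: the lowest gap is factored out as a power of 3, leaving a shorter tower and a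
    final + 1. *)
Lemma complexity_tower k c : complexity (tower k c) <= 3 * tower_exp k c + k.+1.
Proof.
elim: k c => [|k IH] c; first by rewrite tower0 complexity1; lia.
pose d i := c i.+1.
have eS i : tower_exp i.+1 c = (c 0).+1 + tower_exp i d.
  by rewrite /tower_exp big_ord_recl.
have -> : tower k.+1 c = 3 ^ (c 0).+1 * tower k d + 1.
  rewrite /tower big_ord_recl [in X in X + _]/tower_exp big_ord0 addnC big_distrr.
  by congr (_ + _); apply: eq_bigr => i _; rewrite /= eS expnD.
have d0 : 0 < tower k d by apply: leq_trans (tower_bounds k d).1; rewrite expn_gt0.
apply: leq_trans (complexityD _ _) _ => //; first by rewrite muln_gt0 d0 expn_gt0.
have := complexity_exp3M (c 0).+1 d0; have := IH d.
by rewrite complexity1 eS; lia.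
Qed.

(* The dominant part of [tower k c / 3 ^ tower_exp k c = 1 + 3 ^ - (c (k-1)).+1 + ...]
   is the one with the largest index, as in Cantor normal forms. *)
Lemma tower_mono k i c d : i < k -> c i < d i ->
  (forall j, i < j < k -> c j = d j) ->
  tower k d * 3 ^ tower_exp k c < tower k c * 3 ^ tower_exp k d.
Proof.
elim: k => // k IH ik cd eqcd; rewrite !towerS !mulnDl.
rewrite (mulnC (3 ^ tower_exp k.+1 d)) ltn_add2r !tower_expS !expnD.
have [ki|ik'] := leqP k i.
  have ? : i = k by lia.
  subst i; have [_ hd] := tower_bounds k d; have [hc _] := tower_bounds k c.
  have h : 3 * 3 ^ (c k).+1 <= 3 ^ (d k).+1 by rewrite -expnS leq_exp2l.
  have p : 0 < 3 ^ tower_exp k c * 3 ^ (c k).+1 by rewrite muln_gt0 !expn_gt0.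
  have p' : 0 < 3 ^ (c k).+1 by rewrite expn_gt0.
  have q : 0 < 3 ^ tower_exp k d by rewrite expn_gt0.
  have : 2 * (tower k d * (3 ^ tower_exp k c * 3 ^ (c k).+1)) <
      3 * 3 ^ tower_exp k d * (3 ^ tower_exp k c * 3 ^ (c k).+1).
    by rewrite mulnA ltn_mul2r p.
  have : tower k c * (3 ^ tower_exp k d * 3 ^ (d k).+1) >=
      3 ^ tower_exp k c * (3 ^ tower_exp k d * (3 * 3 ^ (c k).+1)).
    by apply: leq_mul => //; rewrite leq_mul2l h orbT.
  by lia.
have -> : c k = d k by apply: eqcd; lia.
rewrite !mulnA ltn_mul2r expn_gt0 /=; apply: IH => // j jk; apply: eqcd; lia.
Qed.

(* By pigeonhole on the finitely many possible values of the difference between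
   the expected complexity [3 * tower_exp k c + k.+1] and the true one. *)
Lemma bounded_defect_not_thin k :
  ~ thin defect_lt k [set n | 0 < n /\ 3 ^ complexity n <= 3 ^ k.+1 * n ^ 3].
Proof.
move=> kP; apply: (@omega_power_not_thin k).
pose color j := [set c : nat -> nat | (forall i, k <= i -> c i = 0) /\
  complexity (tower k c) + j = 3 * tower_exp k c + k.+1].
have tower0' c : 0 < tower k c.
  by apply: leq_trans (tower_bounds k c).1; rewrite expn_gt0.
have ecube c : 3 ^ (3 * tower_exp k c) <= tower k c ^ 3.
  by rewrite mulnC expnM leq_exp2r// (tower_bounds k c).1.
(* As the complexity is at least [3 * tower_exp k c], only the differences 0, ..., k + 1 occur. *)
apply: (@sub_thin _ _ _ _ (\bigcup_(j in [set j | j < k.+2]) color j)).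
  move=> c c0; have := complexity_tower k c; set e := 3 * tower_exp k c => ce.
  exists (e + k.+1 - complexity (tower k c)) => /=; last by split=> //; lia.
  suff : e <= complexity (tower k c) by lia.
  by rewrite -(@leq_exp2l 3)//; exact: leq_trans (ecube c) (cube_le_complexity _).
apply: thin_bigcup => j _; apply: thin_preimage kP.
  move=> c _; split=> //=; apply: (@leq_trans (3 ^ (3 * tower_exp k c + k.+1))).
    by rewrite leq_exp2l// complexity_tower.
  by rewrite expnD mulnC leq_mul2l ecube orbT.
move=> c d [c0 cj] [d0 dj] [i ci cd]; rewrite /defect_lt.
have ik : i < k by rewrite ltnNge; apply/negP => ki; move: ci; rewrite d0.
have : tower k d * 3 ^ tower_exp k c < tower k c * 3 ^ tower_exp k d.
  by apply: tower_mono ci _ => // l /andP[il _]; exact: cd.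
rewrite -(@ltn_exp2r _ _ 3)// !expnMn -!expnM ![tower_exp _ _ * 3]mulnC => h.
rewrite -(@ltn_pmul2r (3 ^ j)) ?expn_gt0//.
rewrite mulnAC -expnD cj [X in _ < X]mulnAC -expnD dj ![3 ^ (_ + k.+1)]expnD.
rewrite !(mulnAC _ (3 ^ k.+1)) ltn_mul2r expn_gt0 /=.
by rewrite mulnC [X in _ < X]mulnC.
Qed.

(** The sets are given by D(n) <= 3^(k+1) (27/64)^i. For i = 2(k+1) the set is empty, since 3
    (27/64)^2 < 1 <= D(n), so thinness sets in at some step. *)
Lemma thin_threshold k : exists i,
  ~ thin defect_lt k
      [set n | 0 < n /\ 64 ^ i * 3 ^ complexity n <= 3 ^ k.+1 * 27 ^ i * n ^ 3] /\
  thin defect_lt k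
      [set n | 0 < n /\ 64 ^ i.+1 * 3 ^ complexity n <= 3 ^ k.+1 * 27 ^ i.+1 * n ^ 3].
Proof.
pose X i := [set n | 0 < n /\ 64 ^ i * 3 ^ complexity n <= 3 ^ k.+1 * 27 ^ i * n ^ 3].
have X0 : ~ thin defect_lt k (X 0).
  move=> h; apply: (@bounded_defect_not_thin k); apply: sub_thin h => n [n0 nk].
  by split=> //; rewrite mul1n muln1.
have Xlast : thin defect_lt k (X (2 * k.+1)).
  apply: sub_thin (thin_set0 _ _) => n [n0]; apply/negP; rewrite -ltnNge.
  apply: (@leq_ltn_trans (3 ^ k.+1 * 27 ^ (2 * k.+1) * 3 ^ complexity n)).
    by rewrite leq_mul2l cube_le_complexity ?orbT.
  by rewrite ltn_mul2r expn_gt0 /= !expnM -expnMn ltn_exp2r.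
apply: contrapT => nX; suff : ~ thin defect_lt k (X (2 * k.+1)) by [].
elim: (2 * k.+1) => // i IH h; by apply: nX; exists i.
Qed.

Lemma stable_not_thin a k : a < 3 ->
  ~ thin defect_lt k [set n | complexity n = a %[mod 3] /\ stable n].
Proof.
move=> a3 aP; have [i [Xi Xi1]] := thin_threshold k; apply: Xi.
set X := (X in thin _ _ X).
apply: (@sub_thin _ _ _ _
    (\bigcup_(b in [set b | b < 3]) (X `&` [set n | complexity n %% 3 = b]))).
  by move=> n Xn; exists (complexity n %% 3) => //=; rewrite ltn_mod.
apply: thin_bigcup => b b3.
(* One of q = 1, 2, 4, at cost e = 0, 2, 4, moves the residue from b to a; always 3^e / q^3 <=
   81/64, with equality for q = 4. *)
have [q [e [q0 qe qc ba]]] : exists q e, [/\ 0 < q, 64 * 3 ^ e <= 81 * q ^ 3,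
    forall n, 0 < n -> complexity (q * n) <= e + complexity n & (b + e) %% 3 = a].
  have q1 : 64 * 3 ^ 0 <= 81 * 1 ^ 3 by [].
  have q2 : 64 * 3 ^ 2 <= 81 * 2 ^ 3 by lia.
  have q4 : 64 * 3 ^ 4 <= 81 * 4 ^ 3 by lia.
  have c1 n : 0 < n -> complexity (1 * n) <= 0 + complexity n by rewrite mul1n.
  have c2 n : 0 < n -> complexity (2 * n) <= 2 + complexity n.
    by move=> n0; rewrite -{2}complexity2; exact: complexityM.
  have c4 n : 0 < n -> complexity (4 * n) <= 4 + complexity n.
    move=> n0; have -> : 4 * n = 2 * (2 * n) by lia.
    by have := c2 n n0; have := c2 (2 * n); lia.
  have [r0|[r2|r4]] : (b + 0) %% 3 = a \/ (b + 2) %% 3 = a \/ (b + 4) %% 3 = a.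
    by case: a b a3 b3 {aP} => [|[|[|]]] // [|[|[|]]] // _ _; rewrite /=; tauto.
  - by exists 1, 0.
  - by exists 2, 2.
  - by exists 4, 4.
have upper n j : 0 < n -> complexity (3 ^ j * (q * n)) <= 3 * j + e + complexity n.
  move=> n0; have qn0 : 0 < q * n by rewrite muln_gt0 q0.
  by have := complexity_exp3M j qn0; have := qc n n0; lia.
pose good := [set n | [/\ X n, complexity n %% 3 = b &
  forall j, complexity (3 ^ j * (q * n)) = 3 * j + e + complexity n]].
pose bad d := [set n | X n /\
  exists j, complexity (3 ^ j * (q * n)) + d.+1 = 3 * j + e + complexity n].
apply: (@sub_thin _ _ _ _ (good `|` \bigcup_(d in [set d | d < e + k.+1]) bad d)).
  move=> n [Xn nb]; have [Gn|nG] := pselect (good n); [by left|right].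
  have [n0 nX] := Xn.
  have [j jn] : exists j, complexity (3 ^ j * (q * n)) <> 3 * j + e + complexity n.
    by apply: contrapT => nj; apply: nG; split=> // j; apply: contrapT => jn; apply: nj; exists j.
  have cj := upper n j n0; set m := 3 ^ j * (q * n) in jn cj *.
  exists (3 * j + e + complexity n - complexity m).-1 => /=; last first.
    by split=> //; exists j; rewrite -/m; lia.
  have m0 : 0 < m by rewrite !muln_gt0 expn_gt0 q0.
  (* The saving is bounded, since D(m) >= 1, m >= 3^j n and D(n) <= 3^(k+1). *)
  suff : 3 * j + e + complexity n <= complexity m + e + k.+1 by lia.
  rewrite -(@leq_exp2l 3)// -(addnA (3 * j)) -(addnA (complexity m)).
  rewrite (expnD 3 (3 * j)) (expnD 3 (complexity m)).
  rewrite (expnD 3 e (complexity n)) (expnD 3 e k.+1).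
  have nk : 3 ^ complexity n <= 3 ^ k.+1 * n ^ 3.
    rewrite -(@leq_pmul2l (64 ^ i)) ?expn_gt0//; apply: leq_trans nX _.
    rewrite mulnAC mulnC leq_mul2r; apply/orP; right.
    by case: (i) => // i'; rewrite leq_exp2r.
  have cm := cube_le_complexity m0.
  have mn : 3 ^ (3 * j) * n ^ 3 <= m ^ 3.
    by rewrite /m !expnMn -!expnM (mulnC j) leq_mul2l leq_pmull ?orbT// expn_gt0 q0.
  apply: (@leq_trans (3 ^ (3 * j) * (3 ^ e * (3 ^ k.+1 * n ^ 3)))).
    by rewrite !leq_mul2l nk !orbT.
  have -> : 3 ^ (3 * j) * (3 ^ e * (3 ^ k.+1 * n ^ 3)) =
      3 ^ (3 * j) * n ^ 3 * (3 ^ e * 3 ^ k.+1) by ring.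
  by rewrite leq_mul2r (leq_trans mn cm) orbT.
apply: thinU.
  (* On [good], multiplication by [q] scales D by the constant 3^e / q^3 and yields stable numbers
     of residue [a]. *)
  apply: (thin_preimage (f := muln q)) aP => [n [Xn nb ng]|m n [_ _ mg] [_ _ ng]].
    have [n0 _] := Xn; have qn0 : 0 < q * n by rewrite muln_gt0 q0.
    have qn : complexity (q * n) = e + complexity n by have := ng 0; rewrite mul1n.
    split; first by rewrite qn (modn_small a3) -ba -nb modnDml addnC.
    by split=> // j _; rewrite ng qn; lia.
  have := mg 0; have := ng 0; rewrite !mul1n !muln0 !add0n /defect_lt => -> ->.
  rewrite !expnD !expnMn => mn.
  have -> : 3 ^ e * 3 ^ complexity m * (q ^ 3 * n ^ 3) =
    3 ^ e * q ^ 3 * (3 ^ complexity m * n ^ 3) by ring.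
  have -> : 3 ^ e * 3 ^ complexity n * (q ^ 3 * m ^ 3) =
    3 ^ e * q ^ 3 * (3 ^ complexity n * m ^ 3) by ring.
  by rewrite ltn_mul2l mn muln_gt0 !expn_gt0 q0.
apply: thin_bigcup => d _.
have /choice[h hP] n : exists j, bad d n ->
    complexity (3 ^ j * (q * n)) + d.+1 = 3 * j + e + complexity n.
  by have [[Xn [j nj]]|nb] := pselect (bad d n); [exists j|exists 0 => /nb].
(* Saving d + 1 ones divides D by at least 3, so the image lies in the next threshold set. For fixed
   [d] the scaling of D is constant, so the order is kept. *)
apply: (thin_preimage (f := fun n => 3 ^ h n * (q * n))) Xi1.
  move=> n Bn; have [[n0 nX] _] := Bn; have hn := hP n Bn.
  split; first by rewrite !muln_gt0 expn_gt0 q0.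
  set m := 3 ^ h n * (q * n) in hn *.
  rewrite -(@leq_pmul2r (3 ^ d.+1)) ?expn_gt0// -mulnA -expnD hn.
  have d3 : 3 <= 3 ^ d.+1 by rewrite expnS leq_pmulr ?expn_gt0.
  apply: (@leq_trans (3 ^ k.+1 * 27 ^ i.+1 * m ^ 3 * 3)); last by rewrite leq_mul2l d3 orbT.
  rewrite /m !expnMn -expnM (mulnC (h n)) !(expnD _ (3 * h n + e)) (expnD _ (3 * h n)).
  rewrite (expnS 64) (expnS 27).
  have := leq_mul qe nX; rewrite -(@leq_pmul2r (3 ^ (3 * h n))) ?expn_gt0//.
  move: (3 ^ (3 * h n)) (3 ^ k.+1) (3 ^ complexity n) (27 ^ i) (64 ^ i) (3 ^ e) (q ^ 3) (n ^ 3).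
  move=> A1 A2 A3 A4 A5 A6 A7 A8 hA.
  have -> : 64 * A5 * (A1 * A6 * A3) = 64 * A6 * (A5 * A3) * A1 by ring.
  by have -> : A2 * (27 * A4) * (A1 * (A7 * A8)) * 3 = 81 * A7 * (A2 * A4 * A8) * A1 by ring.
move=> m n Bm Bn; have hm := hP m Bm; have hn := hP n Bn; rewrite /defect_lt => mn.
rewrite -(@ltn_pmul2r (3 ^ d.+1)) ?expn_gt0//.
rewrite mulnAC -expnD hm [X in _ < X]mulnAC -expnD hn !expnMn -!expnM !(mulnC _ 3).
rewrite !(expnD _ (3 * _ + e)) !(expnD _ (3 * _)).
have -> : 3 ^ (3 * h m) * 3 ^ e * 3 ^ complexity m * (3 ^ (3 * h n) * (q ^ 3 * n ^ 3)) =
  3 ^ (3 * h m) * 3 ^ (3 * h n) * (3 ^ e * q ^ 3) * (3 ^ complexity m * n ^ 3) by ring.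
have -> : 3 ^ (3 * h n) * 3 ^ e * 3 ^ complexity n * (3 ^ (3 * h m) * (q ^ 3 * m ^ 3)) =
  3 ^ (3 * h m) * 3 ^ (3 * h n) * (3 ^ e * q ^ 3) * (3 ^ complexity n * m ^ 3) by ring.
by rewrite ltn_mul2l mn !muln_gt0 !expn_gt0 q0.
Qed.

(** * The two sets of ratios *)

Lemma stable_image_order_type (R : realType) (a : nat) (psi : nat -> R) : a < 3 ->
  (forall m n, complexity m = a %[mod 3] /\ stable m ->
     complexity n = a %[mod 3] /\ stable n ->
     (psi n < psi m)%R <-> defect_lt m n) ->
  let S := psi @` [set n | complexity n = a %[mod 3] /\ stable n] in
  reverse_well_ordered S /\ has_reverse_order_type_omega_omega S.
Proof.
move=> a3 psiE S.
have Sthin x : S x -> exists k,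
    thin (fun y z => (z < y)%R) k (S `&` [set y | (x < y)%R]).
  move=> [n nP <-]; have [k kP] := defect_below_thin nP.2.1; exists k.
  have /choice[h hP] y : exists m, S y ->
      (complexity m = a %[mod 3] /\ stable m) /\ psi m = y.
    by have [[m mP my]|nS] := pselect (S y); [exists m|exists 0].
  apply: (thin_preimage (f := h)) kP => [y [/hP[hy yE] ny]|y z [/hP[hy yE] _] [/hP[hz zE] _]].
    by split; [exact: hy.2.1|apply/psiE; rewrite ?yE].
  by rewrite -{1}yE -{1}zE => /psiE; exact.
split; first exact: reverse_well_ordered_thin.
apply: reverse_order_type_omega_omega_thin => // k kP.
apply: (@stable_not_thin a k a3); apply: (thin_preimage (f := psi)) kP.
  by move=> n nP; exists n.
by move=> m n mP nP; rewrite psiE.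
Qed.

(** Cubing turns 3^floor(||n||/3) into 3^||n|| up to a power of 3 that depends only on the residue
    and cancels. *)
Lemma ratio3_lt (R : realType) m n : complexity m = complexity n %[mod 3] ->
  (n%:R / 3 ^+ (complexity n %/ 3) < m%:R / 3 ^+ (complexity m %/ 3) :> R)%R <->
  defect_lt m n.
Proof.
move=> mn; rewrite ltr_pdivrMr ?exprn_gt0// mulrAC ltr_pdivlMr ?exprn_gt0//.
rewrite -!natrX -!natrM ltr_nat /defect_lt.
suff -> : (3 ^ complexity m * n ^ 3 < 3 ^ complexity n * m ^ 3) =
  (n * 3 ^ (complexity m %/ 3) < m * 3 ^ (complexity n %/ 3)) by [].
rewrite {1}(divn_eq (complexity m) 3) {1}(divn_eq (complexity n) 3) mn.
rewrite !(expnD _ (_ %/ 3 * 3)) !expnM mulnAC [X in _ < X]mulnAC ltn_mul2r expn_gt0/=.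
by rewrite -!expnMn ltn_exp2r// mulnC [X in _ < X]mulnC.
Qed.

(** Excludes n = 1, where [maxvalue_exp3] would fail: ||3|| is 3, but stability of 1 would require
    4. *)
Lemma stable_complexity_gt1 n : stable n -> 1 < complexity n.
Proof.
move=> [n0 /(_ 1 isT)]; have := complexity_gt0 n0.
case: (ltngtP (complexity n) 1) => // n1.
by rewrite n1 (complexity_eq1 n0 n1) complexity3.
Qed.

Lemma ratioE_ratio3 (R : realType) n : stable n ->
  (n%:R / (maxcomplexity (complexity n))%:R =
   3%:R / (nth 0 [:: 3; 4; 6] (complexity n %% 3))%:R *
     (n%:R / 3 ^+ (complexity n %/ 3)) :> R)%R.
Proof.
move=> /stable_complexity_gt1 n1; rewrite maxcomplexityE; last lia.
have := maxvalue_exp3 n1; set w := nth _ _ _ => /(congr1 (fun k => k%:R : R)%R).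
rewrite !natrM natrX => M3.
have w0 : (w%:R != 0 :> R)%R.
  rewrite pnatr_eq0 /w; have := ltn_pmod (complexity n) (isT : 0 < 3).
  by case: (_ %% _) => [|[|[|]]].
have e0 : (3 ^+ (complexity n %/ 3) != 0 :> R)%R by rewrite expf_neq0// pnatr_eq0.
have M0 : ((maxvalue (complexity n))%:R != 0 :> R)%R.
  by rewrite pnatr_eq0 -lt0n maxvalue_gt0.
apply: (mulIf M0); rewrite divfK//.
have -> : ((maxvalue (complexity n))%:R = 3 ^+ (complexity n %/ 3) * w%:R / 3%:R :> R)%R.
  by rewrite -M3 mulrC mulKf// pnatr_eq0.
by field; rewrite w0 e0.
Qed.

Theorem theoremA5 (R : realType) (a : nat) (ha : (a < 3)%N) :
  (reverse_well_ordered (stable_ratios3 R a) /\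
   has_reverse_order_type_omega_omega (stable_ratios3 R a)) /\
  (reverse_well_ordered (stable_ratiosE R a) /\
   has_reverse_order_type_omega_omega (stable_ratiosE R a)).
Proof.
split; apply: stable_image_order_type => // m n [ma mst] [na nst].
  by apply: ratio3_lt; rewrite ma na.
rewrite (ratioE_ratio3 _ mst) (ratioE_ratio3 _ nst) ma na ltr_pM2l.
  by apply: ratio3_lt; rewrite ma na.
by rewrite divr_gt0// ltr0n modn_small//; case: a ha {ma na} => [|[|[|]]].
Qed.
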